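(* Let $\mathfrak{M}=(W,R,V)$ be a classical modal Kripke model and $X\subseteq W$ a team. For every $\mathbf{MT_0^-}$-formula $\phi$: $\mathfrak{M},X\models\phi$ (team semantics) if and only if $\mathfrak{M}^\bullet,X\Vdash^\bullet\phi$ (single-world semantics at the point $X$ of the full powerset model $\mathfrak{M}^\bullet$).
   Context: **Language of $\mathbf{MT_0^-}$.** Fix a set $\mathrm{Prop}$ of propositional variables. Formulas: $\phi::=p\mid\bot\mid\phi\wedge\phi\mid\phi\otimes\phi\mid\phi\vee\phi\mid\phi\to\phi\mid\Box\phi\mid\Diamond\phi$ (negation $\neg\phi$ abbreviates $\phi\to\bot$). **Team semantics.** A classical modal Kripke model is $\mathfrak{M}=(W,R,V)$ with $W\neq\emptyset$, $R\subseteq W\times W$, $V:\mathrm{Prop}\to\wp(W)$. A team is any $X\subseteq W$ (possibly empty). $R(X)=\{w\in W\mid\exists v\in X,\ vRw\}$, $R(w)=R(\{w\})$; $XRY$ means $Y\subseteq R(X)$ and $Y\cap R(w)\ne\emptyset$ for every $w\in X$. Satisfaction: $\mathfrak{M},X\models p$ iff $X\subseteq V(p)$; $\mathfrak{M},X\models\bot$ iff $X=\emptyset$; $\mathfrak{M},X\models\phi\wedge\psi$ iff both hold on $X$; $\mathfrak{M},X\models\phi\vee\psi$ iff $\mathfrak{M},X\models\phi$ or $\mathfrak{M},X\models\psi$; $\mathfrak{M},X\models\phi\otimes\psi$ iff $X=Y\cup Z$ for some $Y,Z\subseteq X$ with $\mathfrak{M},Y\models\phi$ and $\mathfrak{M},Z\models\psi$;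 $\mathfrak{M},X\models\phi\to\psi$ iff for all $Y\subseteq X$, $\mathfrak{M},Y\models\phi$ implies $\mathfrak{M},Y\models\psi$; $\mathfrak{M},X\models\Box\phi$ iff $\mathfrak{M},R(X)\models\phi$; $\mathfrak{M},X\models\Diamond\phi$ iff there is $Y\subseteq W$ with $XRY$ and $\mathfrak{M},Y\models\phi$. **Full powerset model.** $\mathfrak{M}^\bullet=(W^\bullet,\supseteq,R^\circ,R_\otimes,V^\circ)$, where $W^\bullet=\wp(W)$ (including $\emptyset$); $\supseteq$ is the superset relation; $XR^\circ Y$ iff $Y\subseteq R(X)$ and $Y\cap R(w)\ne\emptyset$ for every $w\in X$; $R_\otimes(X,Y,Z)$ iff $X=Y\cup Z$; $X\in V^\circ(p)$ iff $X\subseteq V(p)$. **Single-world semantics $\Vdash^\bullet$.** On a structure $(U,\geq,T,S,V')$ with $\geq$ a partial order, $T$ binary, $S$ ternary (here $U=W^\bullet$, $\geq$ is $\supseteq$, $T=R^\circ$, $S=R_\otimes$, $V'=V^\circ$): $w\Vdash^\bullet p$ iff $w\in V'(p)$; $w\Vdash^\bullet\bot$ iff $w$ is an $\geq$-endpoint, i.e. there is no $v\neq w$ with $w\geq v$; $w\Vdash^\bullet\phi\wedge\psi$ iff $w\Vdash^\bullet\phi$ and $w\Vdash^\bullet\psi$; $w\Vdash^\bullet\phi\vee\psi$ iff $w\Vdash^\bullet\phi$ or $w\Vdash^\bullet\psi$; $w\Vdash^\bullet\phi\otimes\psi$ iff there are $v,u\in U$ with $S(w,v,u)$, $v\Vdash^\bullet\phi$,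 $u\Vdash^\bullet\psi$; $w\Vdash^\bullet\phi\to\psi$ iff for all $v\in U$ with $w\geq v$, $v\Vdash^\bullet\phi$ implies $v\Vdash^\bullet\psi$; $w\Vdash^\bullet\Diamond\phi$ iff there is $v\in U$ with $wTv$ and $v\Vdash^\bullet\phi$; $w\Vdash^\bullet\Box\phi$ iff $v\Vdash^\bullet\phi$ for all $u,v\in U$ with $w\geq u$ and $uTv$. *)

(* Defs.v *)
From mathcomp Require Import all_boot.
From Stdlib Require Import Relation_Definitions.
From mathcomp Require Import classical_sets.

Set Implicit Arguments.
Unset Strict Implicit.
Unset Printing Implicit Defensive.

Local Open Scope classical_set_scope.

(* [Tensor] is the split disjunction of team logic; [Or] is the inquisitive
   (global) disjunction. *)
Inductive formula (P : Type) : Type :=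
| Var of P
| Bot
| And of formula P & formula P
| Tensor of formula P & formula P
| Or of formula P & formula P
| Imp of formula P & formula P
| Box of formula P
| Diamond of formula P.

Arguments Bot {P}.

Record kripke_model (P : Type) : Type := KripkeModel {
  world : Type;
  world_inhabited : inhabited world;
  access : relation world;
  valuation : P -> set world
}.

Arguments access {P} k _ _.
Arguments valuation {P} k _ _.

Section TeamSemantics.
Variables (P : Type) (M : kripke_model P).

Definition successors (X : set (world M)) : set (world M) :=
  [set w | exists2 v, X v & access M v w].

Definition team_access (X Y : set (world M)) : Prop :=
  Y `<=` successors X /\
  forall w, X w -> Y `&` successors [set w] !=set0.

Fixpoint team_sat (X : set (world M)) (phi : formula P) : Prop :=
  match phi with
  | Var p => X `<=` valuation M p
  | Bot => X = set0
  | And a b => team_sat X a /\ team_sat X b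
  | Tensor a b => exists Y Z : set (world M),
      [/\ Y `<=` X, Z `<=` X & X = Y `|` Z] /\ team_sat Y a /\ team_sat Z b
  | Or a b => team_sat X a \/ team_sat X b
  | Imp a b => forall Y : set (world M),
      Y `<=` X -> team_sat Y a -> team_sat Y b
  | Box a => team_sat (successors X) a
  | Diamond a => exists Y : set (world M), team_access X Y /\ team_sat Y a
  end.

End TeamSemantics.

Record point_model (P : Type) : Type := PointModel {
  point : Type;
  point_ge : relation point;
  point_ge_order : order point point_ge;
  point_access : relation point;
  point_tensor : point -> point -> point -> Prop;
  point_val : P -> set point
}.

Arguments point_ge {P} p _ _.
Arguments point_access {P} p _ _.
Arguments point_tensor {P} p _ _ _.
Arguments point_val {P} p _ _.

Section SingleWorldSemantics.
Variables (P : Type) (U : point_model P).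

Definition endpoint (w : point U) : Prop :=
  ~ exists v : point U, v <> w /\ point_ge U w v.

Fixpoint point_sat (w : point U) (phi : formula P) : Prop :=
  match phi with
  | Var p => point_val U p w
  | Bot => endpoint w
  | And a b => point_sat w a /\ point_sat w b
  | Tensor a b => exists v u : point U,
      point_tensor U w v u /\ point_sat v a /\ point_sat u b
  | Or a b => point_sat w a \/ point_sat w b
  | Imp a b => forall v : point U,
      point_ge U w v -> point_sat v a -> point_sat v b
  | Box a => forall u v : point U,
      point_ge U w u -> point_access U u v -> point_sat v a
  | Diamond a => exists v : point U, point_access U w v /\ point_sat v a
  end.

End SingleWorldSemantics.

(* [point_ge X Y] reads X >= Y, so the superset relation is [Y `<=` X]. *)
Lemma superset_order (T : Type) : order (set T) (fun X Y => Y `<=` X).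
Proof.
split; first by move=> X.
- by move=> X Y Z YX ZY; apply: subset_trans ZY YX.
- by move=> X Y YX XY; apply/seteqP; split.
Qed.

Definition powerset_model (P : Type) (M : kripke_model P) : point_model P :=
  {| point := set (world M);
     point_ge := fun X Y => Y `<=` X;
     point_ge_order := @superset_order (world M);
     point_access := @team_access P M;
     point_tensor := fun X Y Z => X = Y `|` Z;
     point_val := fun p => [set X | X `<=` valuation M p] |}.

(* Main.v *)
Require Import Defs.
From mathcomp Require Import all_boot.
From mathcomp Require Import boolp classical_sets.

(** The substantial clause is [Box]: one direction is persistence
    of team satisfaction under subteams; for the other, the successors of [X]
    are already the successors of the subteam of worlds of [X] that have one,
    and this subteam is related by [team_access] to all of its successors. *)

Local Open Scope classical_set_scope.

Section Teams.
Variables (P : Type) (M : kripke_model P).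
Implicit Types (X Y Z : set (world M)) (phi : formula P).

Lemma successorsS {X Y} : Y `<=` X -> successors Y `<=` successors X.
Proof. by move=> YX w [v Yv vw]; exists v => //; exact: YX. Qed.

(** This makes [Diamond] persistent: a world of [Y] still sees a point of [Z], and that point is
    then itself a successor of [Y]. *)
Lemma team_accessS {X Y Z} : Y `<=` X -> team_access X Z ->
  team_access Y (Z `&` successors Y).
Proof.
move=> YX [_ XZ]; split=> [w []//|w Yw].
have [v [Zv [_ -> wv]]] := XZ w (YX w Yw).
by exists v; split; [split=> //|]; exists w.
Qed.

(** Dead ends of [X] must be dropped, since [team_access] wants every world of the source to see a
    point of the target. *)
Lemma team_access_successors X :
  exists2 Y, Y `<=` X & team_access Y (successors X).
Proof.
exists (X `&` [set w | exists v, access M w v]) => [w []//|].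
split=> [v [w Xw wv]|w [Xw [v wv]]].
  by exists w => //; split=> //; exists v.
by exists v; split; exists w.
Qed.

Lemma team_sat_persistent phi X Y :
  Y `<=` X -> team_sat X phi -> team_sat Y phi.
Proof.
elim: phi X Y => [p||a IHa b IHb|a IHa b IHb|a IHa b IHb|a IHa b IHb|a IHa|a IHa]
  X Y YX /=.
- by apply: subset_trans.
- by move=> X0; rewrite -subset0 -X0.
- by case=> /(IHa _ _ YX) Ya /(IHb _ _ YX) Yb.
(* Intersecting both halves of the split of [X] with [Y] splits [Y], by distributivity. *)
- case=> Z [T [[_ _ XZT] [Za Tb]]]; exists (Y `&` Z), (Y `&` T); split.
    by split; [exact: subIsetl|exact: subIsetl|rewrite -setIUr -XZT setIidl].
  by split; [apply: IHa Za|apply: IHb Tb]; exact: subIsetr.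
- by case=> [/(IHa _ _ YX)|/(IHb _ _ YX)]; [left|right].
- by move=> Xab Z ZY; apply: Xab; exact: subset_trans YX.
- by apply: IHa; exact: successorsS.
- case=> Z [XZ Za]; exists (Z `&` successors Y).
  by split; [exact: team_accessS XZ|apply: IHa Za; exact: subIsetl].
Qed.

Lemma endpoint_powerset X : @endpoint P (powerset_model M) X <-> X = set0.
Proof.
split=> [Xend|-> [Y [Y0]]]; last by rewrite /= subset0.
(* The empty team lies below every team, so a nonempty team is no endpoint. *)
by apply: contrapT => X0; apply: Xend; exists set0; split=> // /esym.
Qed.

End Teams.

Theorem lemma3p15 (P : Type) (M : kripke_model P) (X : set (world M))
    (phi : formula P) :
  @team_sat P M X phi <-> @point_sat P (powerset_model M) X phi.
Proof.
elim: phi X => [p||a IHa b IHb|a IHa b IHb|a IHa b IHb|a IHa b IHb|a IHa|a IHa] X /=.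
- by [].
- by rewrite endpoint_powerset.
- by rewrite IHa IHb.
- split=> [[Y [Z [[_ _ XYZ] [/IHa Ya /IHb Zb]]]]|[Y [Z [XYZ [/IHa Ya /IHb Zb]]]]].
    by exists Y, Z.
  (* [point_tensor] only records the union; it yields the two inclusions that [team_sat] asks
     for. *)
  by exists Y, Z; split=> //; split=> //; rewrite XYZ; [exact: subsetUl|exact: subsetUr].
- by rewrite IHa IHb.
- by split=> Xab Y YX /IHa Ya; apply/IHb; exact: Xab.
- split=> [Xa Y Z YX [ZY _]|Xa].
    (* Here [Z] lies in the successors of [Y], hence in those of [X]. *)
    by apply/IHa; apply: team_sat_persistent Xa; exact: subset_trans (successorsS _ _ YX).
  by have [Y YX YRX] := team_access_successors _ _ X; apply/IHa; exact: Xa YRX.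
- by split=> -[Y [XY /IHa Ya]]; exists Y.
Qed.
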